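(* Let $I$ and $K$ be two admissible ideals on a non-empty set $S$ with $K\subseteq I$, let $X$ be a topological space, and let $f:S\to X$ be a function. If $f$ is $I^{K^*}$-convergent to $x\in X$, then $f$ is $I$-convergent to $x$.
   Context: An ideal on a non-empty set $S$ is a family $I\subset 2^S$ closed under finite unions and under taking subsets. It is non-trivial if $S\notin I$ and $I\neq\{\emptyset\}$. A non-trivial ideal on $S$ is admissible if it contains every singleton $\{s\}$, $s\in S$. The associated filter is $F(I)=\{A\subset S: S\setminus A\in I\}$. $\mathrm{Fin}(S)$ is the ideal of all finite subsets of $S$. For an ideal $J$ on $S$, a function $g:S\to X$ is $J$-convergent to $x$ if $\{s\in S: g(s)\notin U\}\in J$ for every neighborhood $U$ of $x$. A function $f:S\to X$ is $I^{K^*}$-convergent to $x$ if there are $M\in F(I)$ and $M_1\in F(K)$ such that the function $g$ given by $g(s)=f(s)$ for $s\in M\cap M_1$, $g(s)=x$ for $s\notin M\cap M_1$, is $\mathrm{Fin}(S)$-convergent to $x$. *)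

(* Defs.v *)
From mathcomp Require Import all_boot.
From mathcomp Require Import boolp classical_sets functions cardinality topology.

Set Implicit Arguments.
Unset Strict Implicit.
Unset Printing Implicit Defensive.

Local Open Scope classical_set_scope.

(* The finite family [D] may be empty, so an ideal always contains [set0]. *)
Record is_ideal (S : Type) (I : set_system S) : Prop := IsIdeal {
  ideal_bigcup : forall D : set_system S,
    finite_set D -> D `<=` I -> I (\bigcup_(A in D) A);
  ideal_subset : forall A B : set S, A `<=` B -> I B -> I A
}.

Definition nontrivial_ideal (S : Type) (I : set_system S) : Prop :=
  [/\ is_ideal I, ~ I [set: S] & I <> [set set0]].

Definition admissible_ideal (S : Type) (I : set_system S) : Prop :=
  nontrivial_ideal I /\ forall s : S, I [set s].

Definition ideal_filter (S : Type) (I : set_system S) : set_system S :=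
  [set A | I (~` A)].

Definition Fin (S : Type) : set_system S := [set A | finite_set A].

Definition ideal_cvg (S : Type) (X : topologicalType) (J : set_system S)
    (g : S -> X) (x : X) : Prop :=
  forall U : set X, nbhs x U -> J [set s | ~ U (g s)].

(* [patch (cst x) A f] is [f] on [A] and constantly [x] off [A]. *)
Definition ideal_Kstar_cvg (S : Type) (X : topologicalType)
    (I K : set_system S) (f : S -> X) (x : X) : Prop :=
  exists M M1 : set S,
    [/\ ideal_filter I M, ideal_filter K M1 &
        ideal_cvg (@Fin S) (patch (cst x) (M `&` M1) f) x].

(* Main.v *)
Require Import Defs.
From mathcomp Require Import all_boot.
From mathcomp Require Import boolp classical_sets functions cardinality topology.

Local Open Scope classical_set_scope.

(** Write [g] for the function equal to [f] on [M `&` M1] and to [x] elsewhere.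
    A point [s] with [f s] outside a neighborhood [U] of [x] either lies off
    [M], or off [M1], or satisfies [g s = f s], hence is one of the finitely
    many points that [g] sends outside [U].  All three exceptional sets belong
    to [I]: the first because [M] is in the filter of [I], the second because
    [K `<=` I] ([ideal_setU] then joins them), and the third because an ideal
    containing the singletons contains the finite sets ([ideal_finite]). *)

Lemma ideal_setU (S : Type) (I : set_system S) (A B : set S) :
  is_ideal I -> I A -> I B -> I (A `|` B).
Proof.
move=> idI IA IB.
have -> : A `|` B = \bigcup_(C in [set A; B]) C.
  by rewrite bigcup_setU !bigcup_set1.
apply: (ideal_bigcup idI); first exact: finite_set2.
by move=> C [->|->].
Qed.

(** A finite set is the union of the finite family of its singletons. *)
Lemma ideal_finite (S : Type) (I : set_system S) (A : set S) :
  is_ideal I -> (forall s, I [set s]) -> finite_set A -> I A.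
Proof.
move=> idI I1 finA.
have -> : A = \bigcup_(C in set1 @` A) C.
  by rewrite bigcup_image bigcup_imset1 image_id.
apply: (ideal_bigcup idI); first exact: finite_image.
by move=> _ [s _ <-].
Qed.

Theorem theorem4p2 (S : Type) (S_nonempty : [set: S] !=set0)
  (I K : set_system S)
  (admI : admissible_ideal I) (admK : admissible_ideal K) (KI : K `<=` I)
  (X : topologicalType) (f : S -> X) (x : X) :
  ideal_Kstar_cvg I K f x -> ideal_cvg I f x.
Proof.
case: admI => -[idI _ _] I1 [M [M1 [IM KM1 cvg_g]]] U nbhsU.
set g := patch _ _ _ in cvg_g.
apply: (@ideal_subset _ _ idI _ ((~` M `|` ~` M1) `|` [set s | ~ U (g s)])).
  move=> s nUfs; have [MM1s|] := pselect ((M `&` M1) s).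
    by right; rewrite /g /= patchT ?inE.
  by rewrite -setCI; left.
apply: ideal_setU => //; last by apply: ideal_finite => //; exact: cvg_g.
by apply: ideal_setU => //; exact: KI.
Qed.
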